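(* (Weak Maximum Principle) Let $\Omega\subset\mathbb{R}^n$, $n\ge2$, be a bounded domain and $T>0$. Suppose that $\phi:\Omega_T\cup P_T\to\mathbb{R}$ is upper semi-continuous in $\Omega_T\cup P_T$ and satisfies, in the viscosity sense, $\Delta_\infty\phi\ge3\phi^2\phi_t$ in $\Omega_T$. Then $$\sup_{\Omega_T}\phi\le\sup_{P_T}\phi=\sup_{\Omega_T\cup P_T}\phi .$$ If instead $\phi:\Omega_T\cup P_T\to\mathbb{R}$ is lower semi-continuous in $\Omega_T\cup P_T$ and satisfies, in the viscosity sense, $\Delta_\infty\phi\le3\phi^2\phi_t$ in $\Omega_T$, then $$\inf_{\Omega_T}\phi\ge\inf_{P_T}\phi=\inf_{\Omega_T\cup P_T}\phi .$$
   Context: Notation: $\Omega_T=\Omega\times(0,T)$; $P_T=(\Omega\times\{0\})\cup(\partial\Omega\times[0,T))$, so $\Omega_T\cup P_T=\overline\Omega\times[0,T)$. $\Delta_\infty\phi=\sum_{i,j}\phi_{x_i}\phi_{x_j}\phi_{x_ix_j}$. $\mathcal S(n)$ is the set of symmetric $n\times n$ real matrices. Semi-jets: for $(y,s)\in\Omega_T$, $(a,p,X)\in\mathbb{R}\times\mathbb{R}^n\times\mathcal S(n)$ belongs to $\mathcal P^+_{\Omega_T}u(y,s)$ if $u(x,t)\le u(y,s)+a(t-s)+\langle p,x-y\rangle+\tfrac12\langle X(x-y),x-y\rangle+o(|t-s|+|x-y|^2)$ as $(x,t)\to(y,s)$ in $\Omega_T$; $\mathcal P^-_{\Omega_T}u=-\mathcal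 P^+_{\Omega_T}(-u)$. $\Delta_\infty\phi\ge3\phi^2\phi_t$ in $\Omega_T$ means: $\phi$ is upper semi-continuous in $\Omega_T$ and $\langle Xp,p\rangle-3a\,\phi(y,s)^2\ge0$ for all $(y,s)\in\Omega_T$, $(a,p,X)\in\mathcal P^+_{\Omega_T}\phi(y,s)$. $\Delta_\infty\phi\le3\phi^2\phi_t$ in $\Omega_T$ means: $\phi$ is lower semi-continuous in $\Omega_T$ and $\langle Yq,q\rangle-3b\,\phi(y,s)^2\le0$ for all $(y,s)\in\Omega_T$, $(b,q,Y)\in\mathcal P^-_{\Omega_T}\phi(y,s)$. *)

(* Defs.v *)
From mathcomp Require Import all_boot all_order all_algebra.
From mathcomp Require Import all_classical all_reals all_analysis.

Set Implicit Arguments.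
Unset Strict Implicit.
Unset Printing Implicit Defensive.

Import Order.TTheory GRing.Theory Num.Theory.
Import numFieldNormedType.Exports.

Local Open Scope classical_set_scope.
Local Open Scope ring_scope.

(* The library norm on 'rV[R]_n is the sup norm; the Euclidean structure is
   given by this inner product. *)
Definition dot (R : realType) (n : nat) (x y : 'rV[R]_n) : R :=
  \sum_(i < n) x ord0 i * y ord0 i.

(* <Xp, p>, vectors being rows *)
Definition quadform (R : realType) (n : nat) (X : 'M[R]_n) (p : 'rV[R]_n) : R :=
  dot (p *m X) p.

Definition domain (R : realType) (n : nat) (Omega : set 'rV[R]_n) : Prop :=
  [/\ Omega !=set0, open Omega & connected Omega].

Definition boundary (X : topologicalType) (A : set X) : set X :=
  closure A `\` A°.

Definition cylinder (R : realType) (n : nat) (Omega : set 'rV[R]_n) (T : R) :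
    set ('rV[R]_n * R) :=
  Omega `*` `]0, T[.

Definition parabolic_boundary (R : realType) (n : nat) (Omega : set 'rV[R]_n)
    (T : R) : set ('rV[R]_n * R) :=
  Omega `*` [set 0] `|` boundary Omega `*` `[0, T[.

(* Functions defined on a set A only are represented by total functions whose
   values off A are irrelevant: in [subspace A] the points off A are isolated,
   so semi-continuity holds there trivially. *)
Definition lsc_on (R : realType) (X : topologicalType) (A : set X)
    (f : X -> R) : Prop :=
  lower_semicontinuous ((fun x => (f x)%:E) : subspace A -> \bar R).

Definition usc_on (R : realType) (X : topologicalType) (A : set X)
    (f : X -> R) : Prop :=
  lsc_on A (fun x => - f x).

Section Viscosity.
Variables (R : realType) (n : nat).
Implicit Types (W : set ('rV[R]_n * R)) (u : 'rV[R]_n * R -> R)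
  (z : 'rV[R]_n * R).

Definition superjet W u z : set (R * 'rV[R]_n * 'M[R]_n) :=
  [set j | let: (a, p, X) := j in let: (y, s) := z in
    X^T = X /\
    exists2 r : 'rV[R]_n * R -> R^o,
      r =o_ (within W (nbhs z))
        (fun w => `|w.2 - s| + dot (w.1 - y) (w.1 - y) : R^o) &
      \forall w \near within W (nbhs z),
        u w <= u z + a * (w.2 - s) + dot p (w.1 - y)
               + 2^-1 * quadform X (w.1 - y) + r w].

Definition subjet W u z : set (R * 'rV[R]_n * 'M[R]_n) :=
  [set - j | j in superjet W (fun w => - u w) z].

(* Delta_oo u >= 3 u^2 u_t in W, in the viscosity sense *)
Definition viscosity_subsolution W u : Prop :=
  usc_on W u /\
  forall z, W z -> forall a p X, superjet W u z (a, p, X) ->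
    0 <= quadform X p - 3 * a * u z ^+ 2.

(* Delta_oo u <= 3 u^2 u_t in W, in the viscosity sense *)
Definition viscosity_supersolution W u : Prop :=
  lsc_on W u /\
  forall z, W z -> forall b q Y, subjet W u z (b, q, Y) ->
    quadform Y q - 3 * b * u z ^+ 2 <= 0.

End Viscosity.

(* Suprema and infima are taken in the extended reals, as the functions need
   not be bounded. *)
Definition sup_on (R : realType) (X : Type) (A : set X) (f : X -> R) : \bar R :=
  ereal_sup [set (f x)%:E | x in A].

Definition inf_on (R : realType) (X : Type) (A : set X) (f : X -> R) : \bar R :=
  ereal_inf [set (f x)%:E | x in A].

(* Main.v *)
Require Import Defs.
From mathcomp Require Import all_boot all_order all_algebra.
From mathcomp Require Import all_classical all_reals all_analysis.
From mathcomp Require Import ring lra.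
Import Order.TTheory GRing.Theory Num.Theory.
Import numFieldNormedType.Exports.
Local Open Scope classical_set_scope.
Local Open Scope ring_scope.

(** Why the principle holds.  Suppose [phi <= M] on the parabolic boundary but
    [phi z0 > M] at some interior [z0 = (x0, t0)].  Subtract from [phi] the barrier
      [L * (t - t0)_+ ^ 2 - e * (x_i - c) ^ 2],
    where [c] lies strictly beyond the values of the coordinate [x_i] on
    [closure Omega].  The spatial part is strictly infinity-superharmonic: its
    gradient is parallel to the [i]-th axis and does not vanish, and its Hessian
    is negative along that axis.  The time part is nondecreasing.  So wherever
    [phi] minus the barrier has a local maximum, the viscosity inequality yields
      [0 <= - 8 * e ^ 3 * (x_i - c) ^ 2 - (something nonnegative) < 0],
    which is absurd ([subsolution_barrier_max]).  The coefficient [3 * phi ^ 2]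
    enters only through its sign, so the zeros of [phi], where the equation
    degenerates in time, do no harm.

    It remains to produce such a maximum.  Fix [T'] between [t0] and [T].  On the
    compact set [closure Omega * [0, T']] the upper semicontinuous function [phi]
    is bounded above, although it may blow up as [t] tends to [T], and [phi] minus
    the barrier attains its maximum ([usc_on_compact_max]).  For [e] small this
    maximum is not on the parabolic boundary, and for [L] large it is not on the
    top [t = T'], because the time part vanishes at [t0].  Hence it is interior
    ([subsolution_le]).

    The statement on supersolutions follows from the invariance of the equation
    under [phi |-> - phi]. *)

(** * Upper semicontinuous functions *)

Section Semicontinuity.
Context {R : realType} {X : topologicalType}.
Implicit Types (A K : set X) (f g : X -> R).

(** The points off [A] are isolated in [subspace A], so upper semicontinuity
    constrains only the neighborhoods, within [A], of points of [A]. *)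
Lemma usc_onP A f : usc_on A f <->
  forall x, A x -> forall c, f x < c -> \forall y \near within A (nbhs x), f y < c.
Proof.
have nbhsA (x : X) V : A x -> nbhs (x : subspace A) V <-> within A (nbhs x) V.
  by move=> Ax; rewrite (nbhs_subspace_in Ax).
split=> [uf x Ax c fxc | uf].
  have /(uf x)[V /nbhsA AV Vf] : ((- c)%:E < (- f x)%:E)%E by rewrite lte_fin ltrN2.
  by apply: filterS (AV Ax) => y /Vf; rewrite lte_fin ltrN2.
suff H (x : X) c : c < - f x ->
    exists2 V, nbhs (x : subspace A) V & forall y : X, V y -> c < - f y.
  by move=> x c; rewrite lte_fin => /H.
move=> cfx; have [Ax|nAx] := pselect (A x).
  exists (fun y => f y < - c); last by move=> y; rewrite ltrNr.
  by apply/nbhsA => //; apply: uf => //; rewrite ltrNr.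
exists [set x] => [|y ->//].
have : globally [set x] [set x] by [].
by rewrite (nbhs_subspace_out nAx).
Qed.

Lemma usc_on_subset {A K f} : K `<=` A -> usc_on A f -> usc_on K f.
Proof.
move=> KA /usc_onP uf; apply/usc_onP => x Kx c fxc.
have := uf x (KA _ Kx) c fxc; rewrite !near_withinE.
by apply: filterS => y fyc /KA.
Qed.

Lemma usc_onD {K f g} : usc_on K f -> continuous g -> usc_on K (fun x => f x + g x).
Proof.
move=> /usc_onP uf cg; apply/usc_onP => x Kx c fgc.
pose d := (c - f x - g x) / 2.
have d0 : 0 < d by rewrite /d; lra.
have gd : \forall y \near within K (nbhs x), g y < g x + d.
  apply: cvg_within; apply: (cvgr_lt (g x)); [exact: cg|lra].
have fd := uf x Kx (f x + d) ltac:(lra).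
by apply: filterS2 fd gd => y; rewrite /d; lra.
Qed.

(** The superlevel sets [[set z | K z /\ f y <= f z]], for [y] in [K], form a
    filter basis; by semicontinuity its cluster points are maximum points. *)
Lemma usc_on_compact_max {K f} : compact K -> K !=set0 -> usc_on K f ->
  exists2 m, K m & forall y, K y -> f y <= f m.
Proof.
move=> cK [k0 Kk0] /usc_onP uf.
pose F := filter_from K (fun y => [set z | K z /\ f y <= f z]).
have FF : ProperFilter F.
  apply: filter_from_proper; last by move=> y Ky; exists y.
  apply: filter_from_filter; first by exists k0.
  move=> y z Ky Kz; have [yz|/ltW zy] := leP (f y) (f z).
    by exists z => // w [Kw zw]; split=> //; split=> //; exact: le_trans zw.
  by exists y => // w [Kw yw]; split=> //; split=> //; exact: le_trans yw.
have [m [Km clm]] : K `&` cluster F !=set0.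
  by apply: cK; exists k0 => // z [].
exists m => // y Ky; rewrite leNgt; apply/negP => /(uf m Km).
move=> ym; have Fy : F [set z | K z /\ f y <= f z] by exists y.
have [z [[Kz yz] /(_ Kz)]] := clm _ _ Fy ym.
by rewrite ltNge yz.
Qed.

End Semicontinuity.

(** * The barrier and its jets *)

Section Barrier.
Context {R : realType} {n : nat}.
Implicit Types (i : 'I_n) (v y : 'rV[R]_n).

Lemma dot_coord i (a : R) v : dot (a *: delta_mx ord0 i) v = a * v ord0 i.
Proof.
rewrite /dot (bigD1 i) //= big1 ?addr0; first by rewrite !mxE !eqxx mulr1.
by move=> j /negPf ji; rewrite !mxE ji andbF mulr0 mul0r.
Qed.

Lemma quadform_coord i (b : R) v :
  quadform (b *: delta_mx i i) v = b * v ord0 i ^+ 2.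
Proof.
rewrite /quadform -scalemxAr.
have -> : v *m delta_mx i i = v ord0 i *: delta_mx ord0 i.
  apply/rowP => j; rewrite !mxE (bigD1 i) //= big1 ?addr0 ?mxE ?eqxx //.
  by move=> k /negPf ki; rewrite !mxE ki mulr0.
by rewrite scalerA dot_coord expr2 mulrA.
Qed.

(** The time profile needs no more than a one-sided quadratic: jets are of first
    order in time, and being constant up to [t0] and nondecreasing after, it
    leaves the value at [t0] unchanged while growing at later times. *)
Definition barrier i (c e t0 L : R) (w : 'rV[R]_n * R) : R :=
  L * Num.max 0 (w.2 - t0) ^+ 2 - e * (w.1 ord0 i - c) ^+ 2.

Lemma barrier_continuous i c e t0 L : continuous (barrier i c e t0 L).
Proof.
move=> w; rewrite /barrier.
apply: cvgB; apply: cvgM; try exact: cvg_cst.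
  rewrite /=; under eq_fun do rewrite expr2.
  have h : (fun x : 'rV[R]_n * R => Num.max 0 (x.2 - t0)) @ w --> Num.max 0 (w.2 - t0).
    apply: (@continuous_max _ _ (fun=> 0) (fun x => x.2 - t0)); first exact: cvg_cst.
    by apply: cvgB; [exact: cvg_snd|exact: cvg_cst].
  by rewrite expr2; apply: cvgM.
rewrite /=; under eq_fun do rewrite expr2.
have h : (fun x : 'rV[R]_n * R => x.1 ord0 i - c) @ w --> w.1 ord0 i - c.
  apply: cvgB; last exact: cvg_cst.
  apply: (@cvg_comp _ _ _ fst (fun M : 'rV[R]_n => M ord0 i) _ (nbhs w.1)); first exact: cvg_fst.
  exact: coord_continuous.
by rewrite expr2; apply: cvgM.
Qed.

(** A one-sided Taylor bound of [t |-> t_+ ^ 2] at [s], valid even where this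
    function fails to be twice differentiable. *)
Lemma sqr_posD (s t : R) :
  Num.max 0 t ^+ 2 <= Num.max 0 s ^+ 2 + 2 * Num.max 0 s * (t - s) + (t - s) ^+ 2.
Proof.
case: (leP 0 t) => t0; case: (leP 0 s) => s0; rewrite ?expr0n/= ?mulr0 ?mul0r ?add0r.
- by rewrite le_eqVlt; apply/orP; left; apply/eqP; ring.
- by nra.
- by nra.
- exact: sqr_ge0.
Qed.

(** Quadratic errors in time are negligible for parabolic jets. *)
Lemma sqr_time_littleo W y (s L : R) :
  (fun w : 'rV[R]_n * R => L * (w.2 - s) ^+ 2 : R^o) =o_ (within W (nbhs (y, s)))
   (fun w => `|w.2 - s| + dot (w.1 - y) (w.1 - y) : R^o).
Proof.
apply/eqoP => eps eps0.
have : \forall w \near within W (nbhs (y, s)), `|w.2 - s| < eps / (`|L| + 1).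
  apply: cvg_within.
  have sc : snd @ nbhs (y, s) --> s by exact: cvg_snd.
  move/cvgrPdistC_lt : sc; apply.
  by rewrite divr_gt0// ltr_wpDl.
apply: filterS => w; rewrite ltr_pdivlMr ?ltr_wpDl// => ws.
have d0 : 0 <= dot (w.1 - y) (w.1 - y).
  by apply: sumr_ge0 => j _; rewrite -expr2 sqr_ge0.
rewrite normrM normrX (ger0_norm (addr_ge0 _ d0))//.
have := normr_ge0 (w.2 - s); have := normr_ge0 L.
move: ws; set a := `|w.2 - s|; set l := `|L| => *.
by nra.
Qed.

(** At a local maximum of the difference, [u] inherits the jet of the barrier;
    the expansion is exact in space, as the barrier is quadratic there. *)
Lemma barrier_superjet {W u i c e t0 L y s} : 0 <= L ->
  (\forall w \near within W (nbhs (y, s)),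
     u w - barrier i c e t0 L w <= u (y, s) - barrier i c e t0 L (y, s)) ->
  superjet W u (y, s)
    (2 * L * Num.max 0 (s - t0),
     (- 2 * e * (y ord0 i - c)) *: delta_mx ord0 i,
     (- 2 * e) *: delta_mx i i).
Proof.
move=> L0 umax; split; first by rewrite linearZ /= trmx_delta.
exists (fun w => L * (w.2 - s) ^+ 2 : R^o); first exact: sqr_time_littleo.
apply: filterS umax => w; rewrite /barrier /= dot_coord quadform_coord !mxE.
have := sqr_posD (s - t0) (w.2 - t0).
have -> : w.2 - t0 - (s - t0) = w.2 - s by ring.
set A := Num.max 0 (w.2 - t0) ^+ 2; set B := Num.max 0 (s - t0).
by move=> /(ler_wpM2l L0); nra.
Qed.

(** The barrier is a strict supersolution: the quadratic form of its jet is
    [- 8 * e ^ 3 * (y_i - c) ^ 2 < 0] and its time slope is nonnegative. *)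
Lemma subsolution_barrier_max {W u i c e t0 L y s} :
  viscosity_subsolution W u -> W (y, s) -> 0 < e -> 0 <= L -> y ord0 i != c ->
  ~ (\forall w \near within W (nbhs (y, s)),
       u w - barrier i c e t0 L w <= u (y, s) - barrier i c e t0 L (y, s)).
Proof.
move=> [_ su] Wz e0 L0 yc /(barrier_superjet L0)/(su _ Wz).
rewrite quadform_coord !mxE !eqxx mulr1.
have m0 : 0 <= Num.max 0 (s - t0) by rewrite le_max lexx.
have q0 : 0 < (y ord0 i - c) ^+ 2 by rewrite exprn_even_gt0//= subr_eq0.
have a0 : 0 <= 3 * (2 * L * Num.max 0 (s - t0)) * u (y, s) ^+ 2.
  by rewrite mulr_ge0 ?sqr_ge0// !mulr_ge0.
have e3 : 0 < e ^+ 3 * (y ord0 i - c) ^+ 2 by rewrite mulr_gt0// exprn_gt0.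
by move: a0 e3; nra.
Qed.

End Barrier.

(** * The maximum principle *)

Section MaximumPrinciple.
Context {R : realType} {n : nat}.
Implicit Types (i : 'I_n) (Omega : set 'rV[R]_n) (T : R) (phi : 'rV[R]_n * R -> R).

Lemma closure_cylinder {Omega T} : open Omega -> 0 < T ->
  closure Omega `*` `[0, T[ `<=` cylinder Omega T `|` parabolic_boundary Omega T.
Proof.
move=> oO T0 [x t] [/= Ox]; rewrite in_itv /= => /andP[t0 tT].
have [xO|nxO] := pselect (Omega x); last first.
  right; right; split; first by split => // /interior_subset.
  by rewrite /= in_itv /= t0.
have [->|tn0] := eqVneq t 0; first by right; left.
by left; split => //=; rewrite in_itv /= tT lt_neqAle eq_sym tn0 t0.
Qed.

Lemma bounded_closure {Omega} : bounded_set Omega -> bounded_set (closure Omega).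
Proof.
move=> [M [Mr OM]]; exists M; split => // N MN x.
have cN : closed [set x : 'rV[R]_n | `|x| <= N].
  apply: (@preimage_closed _ _ (fun x : 'rV[R]_n => `|x|) [set r | r <= N]).
    by move=> ? _; exact: norm_continuous.
  exact: closed_le.
by move/closure_id : cN => /[dup] E -> ; apply: closureS; exact: OM.
Qed.

(** Taking [c] equal to twice a bound keeps [x_i - c] away from zero, which is
    what makes the gradient of the barrier nonzero everywhere. *)
Lemma coord_away_from_bounded i {A : set 'rV[R]_n} : bounded_set A ->
  exists c k : R, 0 < k /\
    forall x, A x -> x ord0 i != c /\ (x ord0 i - c) ^+ 2 <= k.
Proof.
move=> [B [Br AB]].
pose B1 := `|B| + 1; have B10 : 0 < B1 by rewrite /B1 ltr_wpDl.
exists (2 * B1), ((3 * B1) ^+ 2); split; first by rewrite exprn_gt0// mulr_gt0.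
move=> x /(AB B1 _) xB.
have /ler_normlP[h1 h2] : `|x ord0 i| <= B1.
  apply: le_trans (xB _); last by rewrite /B1 (le_lt_trans (ler_norm B))// ltrDl.
  rewrite [leRHS]/Num.Def.normr /= mx_normrE.
  exact: (le_bigmax _ (fun j => `|x j.1 j.2|) (ord0, i)).
by split; [apply/negP => /eqP; lra|nra].
Qed.

(** The contradiction argument.  Working up to a time [T' < T] is what provides
    compactness; the time part of the barrier then excludes a maximum at [T'],
    where [phi] minus the barrier need not be maximal for later times. *)
Lemma subsolution_le {Omega T phi M} : (0 < n)%N -> open Omega ->
  bounded_set Omega -> 0 < T ->
  usc_on (cylinder Omega T `|` parabolic_boundary Omega T) phi ->
  viscosity_subsolution (cylinder Omega T) phi ->
  (forall z, parabolic_boundary Omega T z -> phi z <= M) ->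
  forall z, cylinder Omega T z -> phi z <= M.
Proof.
move=> n0 oO bO T0 uphi su bM [x0 t0] [/= Ox0]; rewrite in_itv /= => /andP[t00 t0T].
rewrite leNgt; apply/negP => Mphi.
pose i : 'I_n := Ordinal n0.
have [c [k [k0 ck]]] := coord_away_from_bounded i (bounded_closure bO).
pose T' := (t0 + T) / 2.
have t0T' : t0 < T' by rewrite /T'; lra.
have T'T : T' < T by rewrite /T'; lra.
pose K := closure Omega `*` `[0, T'].
have KO : K `<=` cylinder Omega T `|` parabolic_boundary Omega T.
  apply: subset_trans (closure_cylinder oO T0) => -[x t] [/= Ox].
  rewrite !in_itv /= => /andP[-> tT']; split => //=.
  by rewrite (le_lt_trans tT').
have Kz0 : K (x0, t0).
  by split; [exact: subset_closure|rewrite /= in_itv /= !ltW].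
have cK : compact K.
  apply: compact_setX; last exact: segment_compact.
  by apply: bounded_closed_compact; [exact: bounded_closure|exact: closed_closure].
have uK := usc_on_subset KO uphi.
have [zB KB phiB] := usc_on_compact_max cK (ex_intro _ _ Kz0) uK.
(* [e] is small enough that the spatial part, at most [e * k], eats only half of
   the gap [phi (x0, t0) - M]. *)
pose e := (phi (x0, t0) - M) / (2 * k).
have e0 : 0 < e by rewrite divr_gt0 ?subr_gt0// mulr_gt0.
have ek : e * k = (phi (x0, t0) - M) / 2 by rewrite /e; field; rewrite lt0r_neq0.
(* [L] makes the time part at [T'] equal to [phi zB - M], which brings the
   maximum of [phi] over [K] down to [M]. *)
pose L := (phi zB - M) / (T' - t0) ^+ 2.
have Tt : 0 < (T' - t0) ^+ 2 by rewrite exprn_gt0// subr_gt0.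
have phi0B := phiB _ Kz0.
have L0 : 0 <= L by rewrite divr_ge0 ?ltW// subr_gt0 (lt_le_trans Mphi).
have LT : L * (T' - t0) ^+ 2 = phi zB - M by rewrite /L divfK// gt_eqF.
pose b := barrier i c e t0 L.
have [[y s] Kys ysmax] : exists2 m, K m & forall w, K w -> phi w - b w <= phi m - b m.
  apply: usc_on_compact_max => //; first by exists (x0, t0).
  apply: usc_onD uK _ => w; apply: cvgN; exact: barrier_continuous.
have := ysmax _ Kz0.
rewrite {1}/b /barrier /= subrr maxxx expr0n/= mulr0 sub0r opprK.
have [Oy s0T'] := Kys; rewrite /= in_itv /= in s0T'; have /andP[s0 sT'] := s0T'.
have [yc yk] := ck _ Oy; rewrite /= in yc yk.
have eyk := ler_wpM2l (ltW e0) yk.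
have ex0 : 0 <= e * (x0 ord0 i - c) ^+ 2 by rewrite mulr_ge0 ?sqr_ge0// ltW.
have m0 : 0 <= L * Num.max 0 (s - t0) ^+ 2 by rewrite mulr_ge0// sqr_ge0.
move=> z0m.
(* On the parabolic boundary the difference is at most [M + e * k], below its
   value at [(x0, t0)]. *)
have Wys : cylinder Omega T (y, s).
  have [//|/bM phiM] := KO _ Kys.
  by exfalso; move: z0m; rewrite /b /barrier/=; lra.
have sT'' : s < T'.
  rewrite lt_neqAle sT' andbT; apply/negP => /eqP sE.
  have := phiB _ Kys; move: z0m; rewrite /b /barrier sE [Num.max _ _]max_r.
    by rewrite [X in X - e * _]LT /=; lra.
  by rewrite subr_ge0 ltW.
apply: (subsolution_barrier_max (t0 := t0) su Wys e0 L0 yc).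
rewrite near_withinE.
have : \forall w \near (y, s), w.2 < T'.
  have sc : snd @ nbhs (y, s) --> s by exact: cvg_snd.
  exact: (cvgr_lt _ sc).
apply: filterS => -[x t] /= tT' [/= Ox]; rewrite in_itv /= => /andP[t0' _].
apply: ysmax; split; first exact: subset_closure.
by rewrite /= in_itv /= !ltW.
Qed.

Lemma parabolic_boundary_neq0 {Omega} T : Omega !=set0 ->
  parabolic_boundary Omega T !=set0.
Proof. by move=> [x Ox]; exists (x, 0); left. Qed.

Lemma subsolution_sup {Omega T phi} : (0 < n)%N -> domain Omega ->
  bounded_set Omega -> 0 < T ->
  usc_on (cylinder Omega T `|` parabolic_boundary Omega T) phi ->
  viscosity_subsolution (cylinder Omega T) phi ->
  (sup_on (cylinder Omega T) phi <= sup_on (parabolic_boundary Omega T) phi)%E /\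
  sup_on (parabolic_boundary Omega T) phi
    = sup_on (cylinder Omega T `|` parabolic_boundary Omega T) phi.
Proof.
move=> n0 [neO oO _] bO T0 uphi su.
have supP : (sup_on (cylinder Omega T) phi <= sup_on (parabolic_boundary Omega T) phi)%E.
  have [z Pz] := parabolic_boundary_neq0 T neO.
  have ub w : parabolic_boundary Omega T w ->
      ((phi w)%:E <= sup_on (parabolic_boundary Omega T) phi)%E.
    by move=> Pw; apply: ereal_sup_ubound; exists w.
  move: ub (ub z Pz); case: (sup_on _ _) => [M|//|//] ub _; last by rewrite leey.
  apply: ge_ereal_sup => _ [w Ww <-]; rewrite lee_fin.
  by apply: (subsolution_le n0 oO bO T0 uphi su) Ww => v /ub; rewrite lee_fin.
split => //; apply/eqP; rewrite eq_le; apply/andP; split.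
  apply: ge_ereal_sup => _ [w Pw <-].
  by apply: ereal_sup_ubound; exists w => //; right.
apply: ge_ereal_sup => _ [w [Ww|Pw] <-]; last by apply: ereal_sup_ubound; exists w.
by apply: le_trans supP; apply: ereal_sup_ubound; exists w.
Qed.

Lemma viscosity_subsolutionN {W phi} : viscosity_supersolution W phi ->
  viscosity_subsolution W (fun z => - phi z).
Proof.
move=> [lphi sphi]; split.
  by rewrite /usc_on; under [X in lsc_on _ X]eq_fun do rewrite opprK.
move=> z Wz a p X sj.
have : subjet W phi z (- a, - p, - X) by exists (a, p, X).
move=> /(sphi _ Wz); rewrite sqrrN.
have -> : quadform (- X) (- p) = - quadform X p.
  rewrite /quadform mulmxN mulNmx opprK /dot -sumrN.
  by apply: eq_bigr => j _; rewrite !mxE mulrN.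
lra.
Qed.

Lemma inf_onE (X : Type) (A : set X) (f : X -> R) :
  inf_on A f = (- sup_on A (fun x => - f x)%R)%E.
Proof. by rewrite /inf_on ereal_infEN image_comp. Qed.

End MaximumPrinciple.

Theorem lemma3p1 (R : realType) (n : nat) (Omega : set 'rV[R]_n) (T : R)
    (hn : (2 <= n)%N) (hOmega : domain Omega) (hbnd : bounded_set Omega)
    (hT : 0 < T) :
  (forall phi : 'rV[R]_n * R -> R,
    usc_on (cylinder Omega T `|` parabolic_boundary Omega T) phi ->
    viscosity_subsolution (cylinder Omega T) phi ->
    (sup_on (cylinder Omega T) phi
       <= sup_on (parabolic_boundary Omega T) phi)%E /\
    sup_on (parabolic_boundary Omega T) phi
      = sup_on (cylinder Omega T `|` parabolic_boundary Omega T) phi) /\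
  (forall phi : 'rV[R]_n * R -> R,
    lsc_on (cylinder Omega T `|` parabolic_boundary Omega T) phi ->
    viscosity_supersolution (cylinder Omega T) phi ->
    (inf_on (parabolic_boundary Omega T) phi
       <= inf_on (cylinder Omega T) phi)%E /\
    inf_on (parabolic_boundary Omega T) phi
      = inf_on (cylinder Omega T `|` parabolic_boundary Omega T) phi).
Proof.
have n0 : (0 < n)%N by exact: leq_trans hn.
split=> phi sc sol; first exact: subsolution_sup.
have [||infP eq] := subsolution_sup (phi := fun z => - phi z) n0 hOmega hbnd hT.
- by rewrite /usc_on; under [X in lsc_on _ X]eq_fun do rewrite opprK.
- exact: viscosity_subsolutionN.
by rewrite !inf_onE leeN2 infP eq.
Qed.
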